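(* For every policy $w:\mathcal S\to\mathcal A$, the map $f:\mathbb{R}^{S\times A}\to\mathbb{R}^{S\times A}$ is Fréchet differentiable on $f^{-1}(\mathcal V_w)$, and its Fréchet derivative $f'(\tilde c)$ at any point $\tilde c\in f^{-1}(\mathcal V_w)$ is a bounded linear map $G:\mathbb{R}^{S\times A}\to\mathbb{R}^{S\times A}$ that does not depend on $\tilde c$, given for $h\in\mathbb{R}^{S\times A}$ by $$[Gh]_{i,a}=\beta P_{ia}^T(I-\beta P_w)^{-1}h_w+h(i,a)\quad\text{for every } i\in\mathcal S,\ a\in\mathcal A.$$
   Context: Finite Markov decision process: $\mathcal S=\{1,\dots,S\}$ is a finite state space, $\mathcal A=\{a_1,\dots,a_A\}$ a finite action space, $p(i,j,a)$ is the probability of moving from state $i$ to state $j$ under action $a$ (so $p(i,j,a)\ge 0$, $\sum_j p(i,j,a)=1$), and $\beta\in(0,1)$ is the discount factor. $\mathbb{R}^{S\times A}$ carries the maximum norm. The map $f:\mathbb{R}^{S\times A}\to\mathbb{R}^{S\times A}$ sends a cost matrix $\tilde c$ to the limit of the $Q$-learning algorithm run with cost $\tilde c$, i.e. to the unique $Q\in\mathbb{R}^{S\times A}$ satisfying $$Q(i,a)=\tilde c(i,a)+\beta\sum_{j\in\mathcal S}p(i,j,a)\min_{b\in\mathcal A}Q(j,b)\quad\text{for all } i\in\mathcal S,\ a\in\mathcal A.$$ For a policy $w:\mathcal S\to\mathcal A$: $\mathcal V_w=\{Q\in\mathbb{R}^{S\times A}: Q(i,w(i))<Q(i,a)\ \forall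 i\in\mathcal S,\ \forall a\ne w(i)\}$ and $f^{-1}(\mathcal V_w)=\{c:f(c)\in\mathcal V_w\}$; $P_w\in\mathbb{R}^{S\times S}$ has entries $[P_w]_{i,j}=p(i,j,w(i))$; $P_{ia}=(p(i,1,a),\dots,p(i,S,a))^T\in\mathbb{R}^S$; $h_w\in\mathbb{R}^S$ is the vector whose $i$th component is $h(i,w(i))$; $I$ is the $S\times S$ identity matrix. *)

(* Defs.v *)
From HB Require Import structures.
From mathcomp Require Import all_boot all_order all_algebra.
From mathcomp Require Import all_classical all_reals all_analysis.
Set Implicit Arguments.
Unset Strict Implicit.
Unset Printing Implicit Defensive.
Import Order.TTheory GRing.Theory Num.Theory.
Import numFieldNormedType.Exports.
Local Open Scope classical_set_scope.
Local Open Scope ring_scope.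

(* The state space is 'I_m.+1 and the action space 'I_n.+1 (both nonempty);
   p i j a is the probability of moving from i to j under action a. The norm
   of 'M[R]_(m.+1, n.+1) is the entrywise maximum norm. *)
Section mdp.
Context {R : realType} {m n : nat}.
Variables (p : 'I_m.+1 -> 'I_m.+1 -> 'I_n.+1 -> R) (beta : R).
Implicit Types (c h Q : 'M[R]_(m.+1, n.+1)) (w : 'I_m.+1 -> 'I_n.+1).

(* The default value Q j ord0 is one of the values minimised over, so it does
   not affect the minimum. *)
Definition min_row Q (j : 'I_m.+1) : R :=
  \big[Num.min/Q j ord0]_(b < n.+1) Q j b.

Definition q_equation c : set 'M[R]_(m.+1, n.+1) :=
  [set Q : 'M[R]_(m.+1, n.+1) | forall i a,
     Q i a = c i a + beta * \sum_(j < m.+1) p i j a * min_row Q j].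

(* A solution of the equation picked by choice; qlim_unique below shows that it
   is the unique one, so that the default value 0 of xget is never used. *)
Definition qlim c : 'M[R]_(m.+1, n.+1) := xget 0 (q_equation c).

Definition strictly_optimal w : set 'M[R]_(m.+1, n.+1) :=
  [set Q : 'M[R]_(m.+1, n.+1) | forall i a, a != w i -> Q i (w i) < Q i a].

Definition policy_mx w : 'M[R]_m.+1 := \matrix_(i, j) p i j (w i).

Definition trans_col (i : 'I_m.+1) (a : 'I_n.+1) : 'cV[R]_m.+1 :=
  \col_j p i j a.

Definition policy_col w h : 'cV[R]_m.+1 := \col_i h i (w i).

Lemma le_entry_norm k l (x : 'M[R]_(k, l)) i j : `|x i j| <= `|x|.
Proof.
rewrite [leRHS]/Num.norm /= mx_normrE; apply/bigmax_geP; right => /=.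
by exists (i, j).
Qed.

Lemma norm_le_entries k l (x : 'M[R]_(k, l)) (M : R) :
  0 <= M -> (forall i j, `|x i j| <= M) -> `|x| <= M.
Proof.
move=> M0 xM; rewrite [leLHS]/Num.norm /= mx_normrE.
by apply/bigmax_leP; split=> // -[i j] _; exact: xM.
Qed.

Lemma min_row_dist Q Q' j : `|min_row Q j - min_row Q' j| <= `|Q - Q'|.
Proof.
have main X Y : min_row X j - min_row Y j <= `|X - Y|.
  rewrite lerBlDl -lerBlDr.
  have H b : min_row X j - `|X - Y| <= Y j b.
    have X_le : min_row X j <= X j b by exact: bigmin_le.
    rewrite lerBlDl (le_trans X_le)// -lerBlDr.
    have := le_entry_norm (X - Y) j b.
    by rewrite !mxE; apply: le_trans; exact: ler_norm.
  by apply: le_bigmin => [|b _]; exact: H.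
by rewrite ler_norml lerNl opprB -{1}normrN opprB !main.
Qed.

Hypotheses (p_ge0 : forall i j a, 0 <= p i j a)
  (p_sum1 : forall i a, \sum_(j < m.+1) p i j a = 1)
  (beta01 : 0 < beta < 1).

Let beta_ge0 : 0 <= beta. Proof. by case/andP: beta01 => /ltW. Qed.

Lemma avg_le i a (v : 'I_m.+1 -> R) M :
  (forall j, `|v j| <= M) -> `|\sum_(j < m.+1) p i j a * v j| <= M.
Proof.
move=> vM; apply: (le_trans (ler_norm_sum _ _ _)).
rewrite -[leRHS]mul1r -(p_sum1 i a) mulr_suml; apply: ler_sum => j _.
by rewrite normrM (ger0_norm (p_ge0 _ _ _)) ler_wpM2l.
Qed.

Lemma qlim_unique c : q_equation c (qlim c) /\
  forall Q, q_equation c Q -> Q = qlim c.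
Proof.
pose T Q : 'M[R]_(m.+1, n.+1) := \matrix_(i, a)
  (c i a + beta * \sum_(j < m.+1) p i j a * min_row Q j).
have TP Q : q_equation c Q <-> Q = T Q.
  split=> [QP|QT i a]; first by apply/matrixP => i a; rewrite mxE; exact: QP.
  by rewrite {1}QT mxE.
have T_ctr : is_contraction (totalfun T).
  exists (NngNum beta_ge0); split; first by case/andP: beta01.
  move=> [X Y] _ /=.
  apply: norm_le_entries => [|i a]; first exact: mulr_ge0.
  rewrite !mxE opprD addrACA subrr add0r -mulrBr -sumrB.
  under eq_bigr do rewrite -mulrBr.
  rewrite normrM ger0_norm// ler_wpM2l//.
  by apply: avg_le => j; exact: min_row_dist.
pose X : completeNormedModType R := HB.pack_for (completeNormedModType R)
  'M[R]_(m.+1, n.+1) (Uniform_isComplete.Build 'M[R]_(m.+1, n.+1)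
                        (@cauchy_cvg 'M[R]_(m.+1, n.+1))).
have [||Q _ QT] := @banach_fixed_point R X setT (totalfun T) T_ctr.
- exact: closedT.
- by exists 0.
have qP : q_equation c (qlim c).
  by apply: (@xgetPex _ 0 (q_equation c)); exists Q; apply/TP.
split=> // Q' /TP Q'T.
exact: (contraction_fixpoint_unique T_ctr I I Q'T ((TP _).1 qP)).
Qed.

Lemma policy_unitmx w : 1%:M - beta *: policy_mx w \in unitmx.
Proof.
rewrite -unitmx_tr unitmxE unitfE; apply/negP => /det0P[v v_neq0 vM].
have {}vM : (1%:M - beta *: policy_mx w) *m v^T = 0.
  by apply: trmx_inj; rewrite trmx_mul trmxK vM trmx0.
have vE i : v^T i 0 = beta * \sum_(j < m.+1) p i j (w i) * v^T j 0.
  have := congr1 (fun x : 'cV[R]_m.+1 => x i 0) vM.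
  rewrite mulmxBl mul1mx -scalemxAl => /eqP; rewrite !mxE subr_eq0 => /eqP ->.
  by congr (_ * _); apply: eq_bigr => j _; rewrite !mxE.
have : `|v^T| <= beta * `|v^T|.
  apply: norm_le_entries => [|i j]; first exact: mulr_ge0.
  rewrite ord1 vE normrM ger0_norm// ler_wpM2l//.
  by apply: avg_le => k; exact: le_entry_norm.
rewrite -subr_ge0 -{2}[`|_|]mul1r -mulrBl; apply/negP; rewrite -ltNge.
rewrite nmulr_rlt0; first by rewrite normr_gt0 trmx_eq0.
by rewrite subr_lt0; case/andP: beta01.
Qed.

End mdp.

(* Main.v *)
Require Import Defs.
From HB Require Import structures.
From mathcomp Require Import all_boot all_order all_algebra.
From mathcomp Require Import all_classical all_reals all_analysis.
Import Order.TTheory GRing.Theory Num.Theory.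
Import numFieldNormedType.Exports.
Local Open Scope classical_set_scope.
Local Open Scope ring_scope.

(** On the open set V_w the row minima of Q are the entries Q(j, w(j)), so the
Q-equation is affine there. If Q = f(c) lies in V_w then, for small h, Q + Gh
still lies in V_w and solves the equation with cost c + h; by uniqueness
f(c + h) = f(c) + Gh, i.e. f is locally affine with linear part G. *)

(** By continuity of [G], [f x + G h] tends to [f x] and so lies in [A] for small [h]. There the
    remainder of the expansion is exactly zero, not merely [o(h)]. *)
Lemma locally_affine_is_diff (R : numFieldType) (V W : normedModType R)
    (f : V -> W) (G : {linear V -> W}) (x : V) (A : set W) :
  continuous G -> nbhs (f x) A ->
  (forall h, A (f x + G h) -> f (h + x) = f x + G h) ->
  is_diff x f G.
Proof.
move=> Gcont Afx fA.
have fxG_cvg : f x + G h @[h --> (0 : V)] --> f x.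
  rewrite -[X in _ --> X]addr0 -(linear0 G).
  by apply: cvgD; [exact: cvg_cst|exact: Gcont].
have fG : \forall h \near (0 : V), f (h + x) = f x + G h.
  near=> h; apply: fA; near: h; exact: fxG_cvg.
have fxG : f \o shift x = cst (f x) + G +o_ (0 : V) id.
  apply/eqaddoP => _/posnumP[e]; near=> h.
  rewrite !fctE /=.
  have -> : f (h + x) = f x + G h by near: h.
  by rewrite subrr normr0 mulr_ge0.
(* ['d f x] is a chosen value; uniqueness of the expansion identifies it with [G]. *)
have dfG := diff_unique Gcont fxG.
by apply: DiffDef => //; apply/diff_locallyP; rewrite dfG.
Unshelve. all: by end_near. Qed.

(** Only finitely many pairs [(i, a)] occur, and each contributes a strict inequality between two
    continuous coordinates. *)
Lemma near_strictly_optimal (R : realType) (m n : nat)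
    (w : 'I_m.+1 -> 'I_n.+1) (Q : 'M[R]_(m.+1, n.+1)) :
  strictly_optimal w Q -> \forall X \near Q, strictly_optimal w X.
Proof.
pose V i a : set 'M[R]_(m.+1, n.+1) :=
  [set X : 'M[R]_(m.+1, n.+1) | a != w i -> X i (w i) < X i a].
move=> wQ; suff : \forall X \near Q, forall i a, V i a X by [].
have Q_filter : Filter (nbhs Q) by exact: nbhs_filter.
apply: (filter_forall (f := fun i X => forall a, V i a X) Q_filter) => i.
apply: (filter_forall (f := V i) Q_filter) => a.
have [->|ai] := eqVneq a (w i).
  by apply: filterE => X; rewrite /V /= eqxx.
have wQia : 0 < Q i a - Q i (w i) by rewrite subr_gt0 wQ.
have cont : (fun X : 'M[R]_(m.+1, n.+1) => X i a - X i (w i)) @ Q -->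
    Q i a - Q i (w i).
  by apply: cvgB; exact: coord_continuous.
near=> X => _; rewrite -subr_gt0; near: X.
exact: (cvgr_gt _ cont).
Unshelve. all: by end_near. Qed.

Lemma strictly_optimal_min_row (R : realType) (m n : nat)
    (w : 'I_m.+1 -> 'I_n.+1) (Q : 'M[R]_(m.+1, n.+1)) j :
  strictly_optimal w Q -> min_row Q j = Q j (w j).
Proof.
move=> wQ; have wmin b : Q j (w j) <= Q j b.
  by have [->//|/wQ/ltW] := eqVneq b (w j).
apply/le_anti/andP; split; first exact: bigmin_le.
(* [wmin] also bounds the default value [Q j ord0] of the minimum. *)
by apply: le_bigmin.
Qed.

Section policy_derivative.
Context {R : realType} {m n : nat}.
Variables (p : 'I_m.+1 -> 'I_m.+1 -> 'I_n.+1 -> R) (beta : R).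
Variable w : 'I_m.+1 -> 'I_n.+1.
Implicit Types (c h Q : 'M[R]_(m.+1, n.+1)).

Definition qlim_deriv h : 'M[R]_(m.+1, n.+1) := \matrix_(i, a)
  (beta * ((trans_col p i a)^T *m invmx (1%:M - beta *: policy_mx p w)
     *m policy_col w h) 0 0 + h i a).

Fact qlim_deriv_is_linear : linear qlim_deriv.
Proof.
move=> k h h'; apply/matrixP => i a.
have col_lin : policy_col w (k *: h + h') =
    k *: policy_col w h + policy_col w h'.
  by apply/matrixP => j l; rewrite !mxE.
rewrite [LHS]mxE col_lin mulmxDr -scalemxAr.
rewrite [in RHS]mxE [(k *: qlim_deriv h) i a]mxE ![qlim_deriv _ i a]mxE.
have addE (A B : 'M[R]_1) : (A + B) 0 0 = A 0 0 + B 0 0 by rewrite mxE.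
have scaleE (A : 'M[R]_1) : (k *: A) 0 0 = k * A 0 0 by rewrite mxE.
rewrite addE scaleE [(k *: h + h') i a]mxE [(k *: h) i a]mxE.
by rewrite !mulrDr mulrCA addrACA.
Qed.

HB.instance Definition _ := GRing.isLinear.Build R
  'M[R]_(m.+1, n.+1) 'M[R]_(m.+1, n.+1) _ qlim_deriv qlim_deriv_is_linear.

Hypotheses (p_ge0 : forall i j a, 0 <= p i j a)
  (p_sum1 : forall i a, \sum_(j < m.+1) p i j a = 1)
  (beta01 : 0 < beta < 1).

Let beta_ge0 : 0 <= beta. Proof. by case/andP: beta01 => /ltW. Qed.

(** This trades the matrix inverse for the evaluation equation of the fixed policy [w] with cost
    [h]. Both the norm bound and the verification of the Q-equation start from this recursion. *)
Lemma qlim_derivE h i a : qlim_deriv h i a =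
  h i a + beta * \sum_(j < m.+1) p i j a * qlim_deriv h j (w j).
Proof.
pose P := policy_mx p w.
pose x := invmx (1%:M - beta *: P) *m policy_col w h.
have GE k b : qlim_deriv h k b = beta * \sum_j p k j b * x j 0 + h k b.
  rewrite mxE -mulmxA mxE; congr (_ * _ + _).
  by apply: eq_bigr => j _; rewrite !mxE.
have xE : (1%:M - beta *: P) *m x = policy_col w h.
  by rewrite mulKVmx// policy_unitmx.
(* x is the diagonal (Gh)(j, w j), by (I - beta P_w) x = h_w. *)
have xG j : x j 0 = qlim_deriv h j (w j).
  rewrite GE; apply/eqP; rewrite addrC -subr_eq; apply/eqP.
  have := congr1 (fun v : 'cV[R]_m.+1 => v j 0) xE.
  rewrite mulmxBl mul1mx -scalemxAl !mxE => <-.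
  by congr (_ - _ * _); apply: eq_bigr => k _; rewrite !mxE.
by rewrite GE addrC; congr (_ + _ * _); apply: eq_bigr => j _; rewrite xG.
Qed.

(** Averaging against [p] does not increase the maximum norm, so the recursion gives
    [|Gh| <= |h| + beta * |Gh|]; solving for [|Gh|] produces the constant. *)
Lemma qlim_deriv_bounded h : `|qlim_deriv h| <= (1 - beta)^-1 * `|h|.
Proof.
have beta1 : 0 < 1 - beta by rewrite subr_gt0; case/andP: beta01.
rewrite ler_pdivlMl// mulrBl mul1r lerBlDr.
apply: norm_le_entries => [|i a]; first by rewrite addr_ge0// mulr_ge0.
rewrite qlim_derivE (le_trans (ler_normD _ _))// lerD ?le_entry_norm//.
rewrite normrM ger0_norm// ler_wpM2l//.
by apply: avg_le => // j; exact: le_entry_norm.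
Qed.

Lemma qlim_deriv_continuous : continuous qlim_deriv.
Proof.
apply: bounded_linear_continuous; apply/linear_boundedP.
near=> M => h; apply: (le_trans (qlim_deriv_bounded h)).
by rewrite ler_wpM2r//; near: M; apply: nbhs_pinfty_ge.
Unshelve. all: by end_near. Qed.

Lemma qlim_addl c h :
  strictly_optimal w (qlim p beta c) ->
  strictly_optimal w (qlim p beta c + qlim_deriv h) ->
  qlim p beta (h + c) = qlim p beta c + qlim_deriv h.
Proof.
move=> wQ wQh; have [_ uniq_ch] := qlim_unique p_ge0 p_sum1 beta01 (h + c).
have [Qc _] := qlim_unique p_ge0 p_sum1 beta01 c.
apply/esym/uniq_ch => i a.
(* Both [Q] and [Q + Gh] attain their row minima at [w j], so the minimum of the sum splits
   additively, and the Q-equation for [c] and the recursion for [h] add up. *)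
under eq_bigr do rewrite (strictly_optimal_min_row _ _ _ _ _ _ wQh) mxE mulrDr.
rewrite [LHS]mxE Qc qlim_derivE.
under [in LHS]eq_bigr do rewrite (strictly_optimal_min_row _ _ _ _ _ _ wQ).
by rewrite big_split/= mulrDr addrACA [in RHS]mxE [h i a + _]addrC.
Qed.

Lemma is_diff_qlim c : strictly_optimal w (qlim p beta c) ->
  is_diff c (qlim p beta) qlim_deriv.
Proof.
move=> wQ.
apply: (locally_affine_is_diff _ _ _ _ _ _ (strictly_optimal w)).
- exact: qlim_deriv_continuous.
- exact: near_strictly_optimal.
- by move=> h; exact: qlim_addl.
Qed.

End policy_derivative.

Theorem proposition1 (R : realType) (m n : nat)
    (p : 'I_m.+1 -> 'I_m.+1 -> 'I_n.+1 -> R) (beta : R)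
    (p_ge0 : forall i j a, 0 <= p i j a)
    (p_sum1 : forall i a, \sum_(j < m.+1) p i j a = 1)
    (beta01 : 0 < beta < 1) (w : 'I_m.+1 -> 'I_n.+1) :
  exists G : {linear 'M[R]_(m.+1, n.+1) -> 'M[R]_(m.+1, n.+1)},
  [/\ exists M : R, forall h : 'M[R]_(m.+1, n.+1), `|G h| <= M * `|h|,
      forall (h : 'M[R]_(m.+1, n.+1)) (i : 'I_m.+1) (a : 'I_n.+1), G h i a =
        beta * ((trans_col p i a)^T *m invmx (1%:M - beta *: policy_mx p w)
                 *m policy_col w h) 0 0 + h i a
    & forall c : 'M[R]_(m.+1, n.+1),
        (qlim p beta @^-1` strictly_optimal w) c ->
        differentiable (qlim p beta) c /\
        'd (qlim p beta) c = G :> ('M[R]_(m.+1, n.+1) -> 'M[R]_(m.+1, n.+1))].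
Proof.
exists (qlim_deriv p beta w); split.
- by exists (1 - beta)^-1 => h; exact: qlim_deriv_bounded.
- by move=> h i a; rewrite mxE.
- by move=> c wQ; have [dQ QG] := is_diff_qlim _ _ w p_ge0 p_sum1 beta01 _ wQ; split.
Qed.
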